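(* Let $\mathbb G=\bigoplus_{p\text{ prime}}(\mathbb N\cup\{0\},+)$. The collection of all net-normal elements in $\{0,1\}^{\mathbb G}$ has measure zero for the Bernoulli measure $\lambda$.
   Context: $\mathbb N=\{1,2,\dots\}$. $\mathbb G=\bigoplus_{p\text{ prime}}(\mathbb N\cup\{0\},+)$ is the additive semigroup of sequences $(k_1,k_2,\dots)$ of nonnegative integers with finitely many nonzero terms (isomorphic to $(\mathbb N,\times)$ via prime factorization). $\lambda$ is the uniform product measure $(\frac12,\frac12)^{\mathbb G}$ on $\{0,1\}^{\mathbb G}$. An anchored rectangular box in $\mathbb G$ is a set of the form $F=\{0,\dots,k_1\}\times\cdots\times\{0,\dots,k_d\}\times\{0\}\times\{0\}\times\cdots$. Let $\mathcal F_{\mathbb G}$ be the family of all anchored rectangular boxes, directed by inclusion. For nonempty finite $K\subset\mathbb G$, $B\in\{0,1\}^K$, $x\in\{0,1\}^{\mathbb G}$ and finite $F\subset\mathbb G$ put $\mathsf N(B,x,F)=|\{g\in\mathbb G:(\forall h\in K)\ h+g\in F\text{ and }x_{h+g}=B(h)\}|$. An element $x\in\{0,1\}^{\mathbb G}$ is net-normal if for every nonempty finite $K\subset\mathbb G$ and every $B\in\{0,1\}^K$ the net $F\mapsto\frac1{|F|}\mathsf N(B,x,F)$, indexed by $F\in\mathcal F_{\mathbb G}$, converges to $2^{-|K|}$; i.e., for every $\varepsilon>0$ there is $F_0\in\mathcal F_{\mathbb G}$ such that $\left|\frac1{|F|}\mathsf N(B,x,F)-2^{-|K|}\right|<\varepsilon$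 for all $F\in\mathcal F_{\mathbb G}$ with $F\supset F_0$. *)

(* Defs.v *)
From HB Require Import structures.
From mathcomp Require Import all_boot all_order all_algebra finmap archimedean.
From mathcomp Require Import all_classical all_reals all_analysis.
From mathcomp Require Import lra zify.

Set Implicit Arguments.
Unset Strict Implicit.
Unset Printing Implicit Defensive.

Import Order.TTheory GRing.Theory Num.Theory.

Local Open Scope classical_set_scope.
Local Open Scope fset_scope.
Local Open Scope ring_scope.

Definition primes_type : Type := {p : nat | prime p}.
HB.instance Definition _ := Countable.on primes_type.

Definition GG : Type := {fsfun primes_type -> nat with 0%N}.
HB.instance Definition _ := Countable.on GG.

Definition GG_coord (g : GG) : primes_type -> nat :=
  fun_of_fsfun g.
Coercion GG_coord : GG >-> Funclass.

Definition GG_add (g h : GG) : GG :=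
  [fsfun p in finsupp g `|` finsupp h => (g p + h p)%N].

Lemma GG_addE (g h : GG) p : GG_add g h p = (g p + h p)%N.
Proof.
rewrite /GG_add /GG_coord fsfunE in_fsetU.
by case: finsuppP => //= _; case: finsuppP.
Qed.

Lemma GG_addA : associative GG_add.
Proof. by move=> a b c; apply/fsfunP => p; rewrite -!/(GG_coord _ _) !GG_addE addnA. Qed.

Lemma GG_addC : commutative GG_add.
Proof. by move=> a b; apply/fsfunP => p; rewrite -!/(GG_coord _ _) !GG_addE addnC. Qed.

Lemma GG_add0 : left_id ([fsfun] : GG) GG_add.
Proof.
by move=> a; apply/fsfunP => p; rewrite -!/(GG_coord _ _) GG_addE /GG_coord fsfunE.
Qed.

HB.instance Definition _ := GRing.isNmodule.Build GG GG_addA GG_addC GG_add0.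

(* Tuples (k_1, ..., k_d) padded with zeros are exactly the elements k of GG. *)
Definition anchored_box (F : {fset GG}) : Prop :=
  exists k : GG, forall g : GG, g \in F <-> forall p, (g p <= k p)%N.

Lemma anchored_box_exists (k : GG) :
  exists F : {fset GG}, forall g : GG, g \in F <-> forall p, (g p <= k p)%N.
Proof.
pose A := [set g : GG | forall p, (g p <= k p)%N].
have fA : finite_set A.
  pose M := (\max_(p : finsupp k) k (val p))%N.+1.
  pose f (g : GG) : {ffun finsupp k -> 'I_M.+1} := [ffun p => inord (g (val p))].
  have fi : {in A &, injective f}.
    move=> g h; rewrite !inE /A /= => gA hA /ffunP fE; apply/fsfunP => p.
    rewrite -!/(GG_coord _ _).
    have [pk|pk] := boolP (p \in finsupp k); last first.
      have k0 : k p = 0%N by exact: fsfun_dflt.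
      by move: (gA p) (hA p); rewrite k0 !leqn0 => /eqP-> /eqP->.
    have kM : (k p < M.+1)%N.
      by rewrite ltnS leqW//; exact: (leq_bigmax [` pk]).
    move: (fE [` pk]); rewrite !ffunE => /(congr1 val).
    by rewrite /= !inordK ?(leq_ltn_trans _ kM).
  have [g _] := Pinj fi; rewrite -(eq_finite_set (card_image g)).
  exact: finite_finset.
exists (fset_set A) => g; by rewrite in_fset_set// inE.
Qed.

Definition config : Type := GG -> bool.
HB.instance Definition _ := Pointed.on config.

Definition cylinder (K : {fset GG}) (B : {ffun K -> bool}) : set config :=
  [set x | forall h : K, x (val h) = B h].

(* They generate the product sigma-algebra of {0,1}^GG. *)
Definition cylinders : set (set config) :=
  [set C | exists (K : {fset GG}) (B : {ffun K -> bool}), C = cylinder B].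

HB.instance Definition _ :=
  Measurable.copy config (g_sigma_algebraType cylinders).

(* These values on cylinders characterize the product measure; its existence
   is uniform_product_exists below. *)
Definition is_uniform_product (R : realType) (lambda : probability config R)
    : Prop :=
  forall (K : {fset GG}) (B : {ffun K -> bool}),
    lambda (cylinder B) = ((2^-1) ^+ #|` K|)%:E.

(* fset_set sends infinite sets to fset0; the set below is finite as soon as
   K is nonempty (occ_finite). *)
Definition occ (K : {fset GG}) (B : {ffun K -> bool}) (x : config)
    (F : {fset GG}) : nat :=
  #|` fset_set [set g : GG |
        forall h : K, val h + g \in F /\ x (val h + g) = B h] |.

Lemma occ_finite (K : {fset GG}) (B : {ffun K -> bool}) (x : config)
    (F : {fset GG}) : K != fset0 ->
  finite_set [set g : GG |
    forall h : K, val h + g \in F /\ x (val h + g) = B h].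
Proof.
move=> /fset0Pn[k kK].
apply: (@sub_finite_set _ _ ((fun g : GG => k + g) @^-1` [set` F])).
  by move=> g /(_ [` kK]) [].
apply: finite_preimage; last exact: finite_fset.
move=> g h _ _ gh; apply/fsfunP => p.
rewrite -!/(GG_coord _ _).
by have := GG_addE k g p; rewrite -[GG_add k g]/(k + g) gh GG_addE => /addnI.
Qed.

Definition net_normal (R : realType) : set config :=
  [set x | forall (K : {fset GG}) (B : {ffun K -> bool}), K != fset0 ->
     forall e : R, 0 < e ->
     exists F0 : {fset GG}, anchored_box F0 /\
     forall F : {fset GG}, anchored_box F -> F0 `<=` F ->
       `| (occ B x F)%:R / (#|` F|)%:R - (2^-1) ^+ #|` K| | < e].

Section existence.
Context (R : realType).

(* A uniform point of [0, 1[ has independent fair binary digits; they are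
   indexed by GG through its countability. *)
Let unit_itv : measurable (`[0, 1[ : set R).
Proof. exact: measurable_itv. Qed.

Let P := mrestr (@lebesgue_measure R) unit_itv.

HB.instance Definition _ := Measure.copy P
  (mrestr (@lebesgue_measure R) unit_itv).

Let P_setT : P [set: R] = 1%:E.
Proof.
by rewrite /P /mrestr setTI lebesgue_measure_itv/= lte_fin ltr01 sube0.
Qed.

HB.instance Definition _ := @Measure_isProbability.Build _ _ R P P_setT.

Let bit n (t : R) : bool := odd (Num.truncn (t * 2 ^+ n.+1)).

Let truncn_half n (t : R) : 0 <= t ->
  Num.truncn (t * 2 ^+ n) = (Num.truncn (t * 2 ^+ n.+1))./2.
Proof.
move=> t0; have y0 : 0 <= t * 2 ^+ n.+1 by rewrite mulr_ge0.
have /andP[] := truncn_itv y0.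
set m := Num.truncn (t * _); rewrite exprSr mulrA => m1 m2.
apply: truncn_def.
have h1 : ((m./2).*2%:R : R) <= m%:R.
  by rewrite ler_nat -[leqRHS]odd_double_half leq_addl.
have h2 : (m.+1%:R : R) <= (m./2).*2%:R + 2.
  by rewrite -natrD ler_nat -[X in (X.+1 <= _)%N]odd_double_half; case: odd; lia.
rewrite -muln2 natrM in h1 h2; rewrite -[(m./2).+1%:R]natr1.
apply/andP; split; lra.
Qed.

Fixpoint word (b : nat -> bool) N : nat :=
  if N is N'.+1 then (b N' + (word b N').*2)%N else 0%N.

Let word_lt b N : (word b N < 2 ^ N)%N.
Proof. by elim: N => //= N; rewrite expnS mul2n; case: (b N); lia. Qed.

Let bits_word b N (t : R) : 0 <= t < 1 ->
  (forall n, (n < N)%N -> bit n t = b n) <-> Num.truncn (t * 2 ^+ N) = word b N.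
Proof.
move=> /andP[t0 t1]; elim: N => [|N IH] /=.
  by split=> // _; rewrite expr0 mulr1; apply: truncn_def; rewrite t0.
have tE : Num.truncn (t * 2 ^+ N.+1)
    = (bit N t + (Num.truncn (t * 2 ^+ N)).*2)%N.
  by rewrite (truncn_half N) // odd_double_half.
split=> [H|H].
  rewrite tE H //; congr (_ + _.*2)%N; apply/IH => n nN.
  by apply: H; rewrite ltnS ltnW.
have HN : bit N t = b N.
  by rewrite /bit H oddD odd_double addbF; case: (b N).
move=> n; rewrite ltnS leq_eqVlt => /predU1P[->//|]; apply: IH.2.
move: H; rewrite tE HN => /addnI /(congr1 half).
by rewrite !doubleK.
Qed.

Let C (S : {fset nat}) (b : nat -> bool) : set R :=
  [set t | forall n, n \in S -> bit n t = b n].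

Let measurable_bit n (c : bool) : measurable [set t | bit n t = c].
Proof.
suff H : measurable [set t | bit n t].
  case: c => //; rewrite (_ : [set _ | _] = ~` [set t | bit n t]).
    exact: measurableC.
  by apply/seteqP; split=> t /= => [->|/negP/negbTE].
rewrite (_ : [set t | _] = (\bigcup_(m in [set m | odd m])
    `[(m%:R / 2 ^+ n.+1 : R)%R, (m.+1%:R / 2 ^+ n.+1 : R)%R[)%classic).
  by apply: (@bigcup_measurable _ (measurableTypeR R)) => m _; exact: measurable_itv.
apply/seteqP; split=> t /=.
  move=> bt; exists (Num.truncn (t * 2 ^+ n.+1)) => //=.
  rewrite in_itv/= ler_pdivrMr ?exprn_gt0// ltr_pdivlMr ?exprn_gt0//.
  apply: truncn_itv; rewrite mulr_ge0 //.
  rewrite leNgt; apply/negP => t0; move: bt.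
  rewrite /bit truncn_floor leNgt pmulr_llt0 ?exprn_gt0//.
  by rewrite t0.
move=> [m om]; rewrite /= in_itv/= ler_pdivrMr ?exprn_gt0// ltr_pdivlMr ?exprn_gt0//.
by move=> /truncn_def; rewrite /bit => ->.
Qed.

Let measurable_C S b : measurable (C S b).
Proof.
rewrite (_ : C S b =
    (\bigcap_(n in [set` S]) [set t | bit n t = b n])%classic) //.
by apply: fin_bigcap_measurable => // n _; exact: measurable_bit.
Qed.

Let P_full N b : P (C [fset n in iota 0 N] b) = ((2^-1) ^+ N)%:E.
Proof.
rewrite /P /mrestr (_ : (_ `&` _)%classic =
   [set` `[(word b N)%:R / 2 ^+ N, (word b N).+1%:R / 2 ^+ N[ ]).
  rewrite lebesgue_measure_itv/= lte_fin ltr_pM2r ?invr_gt0 ?exprn_gt0//.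
  by rewrite ltr_nat ltnSn -EFinD -mulrBl -natrB// subSnn mul1r exprVn.
have p0 : 0 < 2 ^+ N :> R by rewrite exprn_gt0.
apply/seteqP; split=> t /=; rewrite !in_itv/= ler_pdivrMr// ltr_pdivlMr//.
  move=> [H t01]; rewrite -((bits_word b N t01).1 _).
    by apply: truncn_itv; rewrite mulr_ge0 ?(ltW p0) //; case/andP: t01.
  by move=> n nN; apply: H; rewrite !inE mem_iota.
move=> H.
have t01 : 0 <= t < 1.
  case/andP: H => H1 H2; apply/andP; split.
    by rewrite -(pmulr_lge0 _ p0) (le_trans _ H1).
  rewrite -(ltr_pM2r p0) mul1r (lt_le_trans H2)// -natrX ler_nat.
  exact: word_lt.
split=> // n; rewrite !inE mem_iota add0n /= => nN.
by apply: (bits_word b N t01).2 nN; exact: truncn_def.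
Qed.

Let P_C S b : P (C S b) = ((2^-1) ^+ #|` S|)%:E.
Proof.
have [N SN] : exists N, S `<=` [fset n in iota 0 N].
  exists (\max_(n <- S) n)%N.+1; apply/fsubsetP => n nS.
  have Sn : (n <= \max_(n <- S) n)%N by exact: (@leq_bigmax_seq _ _ xpredT id).
  by rewrite !inE mem_iota; case: posnP => //= n0; rewrite ltnS.
set Fu := [fset n in iota 0 N] in SN.
have [k] := ubnP #|` Fu `\` S|; elim: k S b SN => // k IH S b SN.
rewrite ltnS => kk.
have [FS|[i]] := fset_0Vmem (Fu `\` S).
  have -> : S = Fu.
    by apply/eqP; rewrite eqEfsubset SN/= -fsetD_eq0 FS.
  by rewrite P_full card_fseq undup_id ?iota_uniq// size_iota.
rewrite in_fsetD => /andP[iS iF].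
have step b' : P (C (i |` S) b') = (2^-1 ^+ #|` S|.+1)%:E.
  rewrite IH ?cardfsU1 ?iS//; first by rewrite fsubUset fsub1set iF.
  move: kk; rewrite (cardfsD1 i (Fu `\` S)) in_fsetD iS iF.
  by rewrite fsetDDl [S `|` _]fsetUC.
pose b' n := if n == i then ~~ b n else b n.
have -> : C S b = (C (i |` S)%fset b `|` C (i |` S)%fset b')%classic.
  apply/seteqP; split=> t /=.
    move=> H; have [bi|bi] := eqVneq (bit i t) (b i); [left|right] => n.
      by rewrite !inE => /predU1P[->//|]; exact: H.
    rewrite !inE /b' => /orP[/eqP->|nS].
      by rewrite eqxx; move: bi; case: bit; case: (b i).
    by rewrite ifN ?H//; apply: contraNneq iS => <-.
  move=> [] H n nS; rewrite H ?inE ?nS ?orbT// /b' ifN//.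
  by apply: contraNneq iS => <-.
rewrite measureU//.
- rewrite [LHS](_ : _ = (2^-1 ^+ #|` S|.+1)%:E + (2^-1 ^+ #|` S|.+1)%:E)%E.
    rewrite -EFinD; congr (_%:E); rewrite exprS; set a := _ ^+ _; lra.
  by congr (_ + _)%E; exact: step.
- exact: measurable_C.
- exact: measurable_C.
- apply/seteqP; split=> t //= [H1 H2].
  have iS' : i \in i |` S by rewrite in_fsetU in_fset1 eqxx.
  by move: (H2 i iS'); rewrite (H1 i iS') /b' eqxx; case: (b i).
Qed.

Let X (t : measurableTypeR R) : config := fun g => bit (choice.pickle g) t.

Let X_cylinder (K : {fset GG}) (B : {ffun K -> bool}) :
  exists b, X @^-1` cylinder B = C [fset choice.pickle g | g in K] b.
Proof.
pose b n := if (choice.unpickle n : option GG) is Some g then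
              if insub g is Some h then B h else false else false.
have bE (h : K) : b (choice.pickle (val h)) = B h by rewrite /b choice.pickleK valK.
exists b; apply/seteqP; split=> t /=.
  by move=> H _ /imfsetP[/= g gK ->]; rewrite (bE [` gK]) -H.
by move=> H h; rewrite -bE -H//; apply: in_imfset; exact: valP.
Qed.

Let measurable_X : measurable_fun setT X.
Proof.
apply: (@measurability _ _ _ _ _ _ cylinders) => //.
move=> _ [_ [K [B ->]] <-]; rewrite setTI.
by have [b ->] := X_cylinder B; exact: measurable_C.
Qed.

HB.instance Definition _ := isMeasurableFun.Build _ _ (measurableTypeR R) config X measurable_X.

Lemma uniform_product_exists :
  exists lambda : probability config R, is_uniform_product lambda.
Proof.
exists (distribution P X) => K B; rewrite /distribution /pushforward.
have [b Xb] := X_cylinder B.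
rewrite [LHS](_ : _ = P (X @^-1` cylinder B))//.
by rewrite Xb P_C card_imfset//; exact: (pcan_inj choice.pickleK).
Qed.

End existence.

(* Main.v *)
Require Import Defs.
From mathcomp Require Import all_boot all_order all_algebra finmap.
From mathcomp Require Import all_classical all_reals all_analysis.
From mathcomp Require Import lra.

Set Implicit Arguments.
Unset Strict Implicit.
Unset Printing Implicit Defensive.

Import Order.TTheory GRing.Theory Num.Theory.
Import numFieldNormedType.Exports.

Local Open Scope fset_scope.
Local Open Scope classical_set_scope.
Local Open Scope ring_scope.

(** Almost every configuration already fails the frequency condition for the
    one-point pattern [K = {0}], [B = 1], that is, the condition that the
    density of ones in [F] tends to 1/2.

    Fix an anchored box [F0]. For each prime [p] in which [F0] is flat, the union
    of [F0] and its translate [F0 + e_p] is again an anchored box, with twice as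
    many points. There are infinitely many such [p], and the layers [F0 + e_p]
    are pairwise disjoint sets of the same finite size, so the values of a
    random [x] on them are independent: almost surely [x] is constantly 1 on
    some layer ([negligible_no_full_layer], by the product formula
    [lambda_ones_avoiding]). There are countably many boxes, so almost surely
    every box [F0] has such a layer.

    A full layer raises the density from [d] to [(d + 1) / 2]. If every box
    containing [F0] had density within 1/6 of 1/2, this would hold for [F0] itself
    and for the doubled box, giving both [d > 1/3] and [(d + 1) / 2 < 2/3], which
    is absurd ([net_normal_no_full_layer]). Having infinitely many generators is
    what makes this work: each of the infinitely many fresh directions offers
    an independent chance, of the same positive probability, to double the box
    by a full layer. *)

(** * Disjoint finite sets filled with ones *)

Definition all_ones (T : {fset GG}) : set config :=
  [set x | forall g, g \in T -> x g].

Lemma all_onesU (S T : {fset GG}) :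
  all_ones (S `|` T)%fset = all_ones S `&` all_ones T.
Proof.
apply/seteqP; split=> x /=.
  by move=> H; split=> g gS; apply: H; rewrite in_fsetU gS ?orbT.
by move=> [HS HT] g; rewrite in_fsetU => /orP[/HS|/HT].
Qed.

(** The prescribed set [T] of ones is there only to make the recursion
    [ones_avoiding_cons] close up; the events of interest have [T] empty. *)
Definition ones_avoiding (s : seq {fset GG}) (T : {fset GG}) : set config :=
  all_ones T `&` [set x | forall S, S \in s -> ~ all_ones S x].

Lemma ones_avoiding_cons S s T :
  ones_avoiding (S :: s) T = ones_avoiding s T `\` ones_avoiding s (T `|` S)%fset.
Proof.
rewrite /ones_avoiding all_onesU; apply/seteqP; split=> x /=.
  move=> [xT H]; split.
    by split=> // S' S's; apply: H; rewrite inE S's orbT.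
  by move=> [[_ xS] _]; apply: (H S) xS; rewrite inE eqxx.
move=> [[xT xs] H]; split=> // S'; rewrite inE => /predU1P[->|/xs//].
by move=> xS; apply: H.
Qed.

Lemma all_ones_cylinder T : all_ones T = cylinder [ffun _ : T => true].
Proof.
apply/seteqP; split=> x /=.
  by move=> H h; rewrite ffunE; apply: H; exact: valP.
by move=> H g gT; have := H [` gT]; rewrite ffunE.
Qed.

Lemma measurable_all_ones T : measurable (all_ones T).
Proof.
rewrite all_ones_cylinder; apply: sub_sigma_algebra.
by exists T, [ffun _ : T => true].
Qed.

Lemma measurable_ones_avoiding s T : measurable (ones_avoiding s T).
Proof.
elim: s T => [|S s IH] T; last by rewrite ones_avoiding_cons; exact: measurableD.
rewrite /ones_avoiding (_ : [set x | _] = setT) ?setIT.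
  exact: measurable_all_ones.
by apply/seteqP; split.
Qed.

(** Independence on disjoint coordinates, obtained from the values on cylinders
    alone: excluding one more set [S] subtracts the same event with [S] added to
    the prescribed ones. By induction that event has [2^-|S|] times the original
    measure, whence the factor [1 - 2^-|S|]. *)
Lemma lambda_ones_avoiding (R : realType) (lambda : probability config R)
    (lambda_uniform : is_uniform_product lambda) s T :
  pairwise fdisjoint (T :: s) ->
  lambda (ones_avoiding s T) =
    (2^-1 ^+ #|` T| * \prod_(S <- s) (1 - 2^-1 ^+ #|` S|))%:E.
Proof.
elim: s T => [|S s IH] T.
  move=> _; rewrite big_nil mulr1 /ones_avoiding (_ : [set x | _] = setT).
    by rewrite setIT all_ones_cylinder lambda_uniform.
  by apply/seteqP; split.
rewrite /= => /and3P[/andP[TS Ts] Ss ss].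
have TsP : pairwise fdisjoint (T :: s) by rewrite /= Ts.
have TSsP : pairwise fdisjoint ((T `|` S)%fset :: s).
  rewrite /= ss andbT; apply/allP => S' S's.
  by rewrite fdisjointUX (allP Ts) ?(allP Ss).
rewrite ones_avoiding_cons measureD; [|exact: measurable_ones_avoiding..|].
  rewrite (_ : _ `&` _ = ones_avoiding s (T `|` S)%fset); last first.
    by apply: setIidr => x; rewrite /ones_avoiding all_onesU => -[[]].
  have cardTS : #|` (T `|` S)%fset| = (#|` T| + #|` S|)%N.
    by rewrite cardfsU (eqP TS) cardfs0 subn0.
  rewrite [X in (X - _)%E](IH T TsP) [X in (_ - X)%E](IH _ TSsP).
  rewrite -EFinB big_cons cardTS exprD; congr (_%:E).
  by rewrite mulrBl mul1r mulrBr mulrA.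
apply: (le_lt_trans _ (ltry 1)).
exact: probability_le1 (measurable_ones_avoiding _ _).
Qed.

(** Borel-Cantelli in its simplest form: arbitrarily long lists of disjoint
    sets of size [n] bound the measure by every power of [1 - 2^-n]. *)
Lemma negligible_avoiding (R : realType) (lambda : probability config R)
    (lambda_uniform : is_uniform_product lambda)
    (n : nat) (s : nat -> seq {fset GG}) (A : set config) :
  (forall m, [/\ size (s m) = m, pairwise fdisjoint (s m) &
     {in s m, forall S, #|` S| = n}]) ->
  (forall m x, A x -> forall S, S \in s m -> ~ all_ones S x) ->
  lambda.-negligible A.
Proof.
move=> sP As; pose q : R := 1 - 2^-1 ^+ n.
have lambda_avoidingE m : lambda (ones_avoiding (s m) fset0) = (q ^+ m)%:E.
  have [sm dm cm] := sP m.
  rewrite (lambda_ones_avoiding lambda_uniform); last first.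
    by rewrite /= dm andbT; apply/allP => S _; rewrite fdisjoint0X.
  rewrite cardfs0 expr0 mul1r; congr (_%:E).
  rewrite (eq_big_seq (fun=> q)) ?big_const_seq ?count_predT ?sm ?iter_mulr_1//.
  by move=> S /cm ->.
pose B := \bigcap_m ones_avoiding (s m) fset0.
have mB : measurable B.
  by apply: bigcapT_measurable => m; exact: measurable_ones_avoiding.
exists B; split=> //; last first.
  move=> x Ax m _; split; first by move=> g; rewrite in_fset0.
  by move=> S; exact: As.
have q01 : `|q| < 1.
  have p0 : 0 < 2^-1 ^+ n :> R by rewrite exprn_gt0.
  have p1 : 2^-1 ^+ n <= 1 :> R by rewrite exprn_ile1// invf_le1// ler1n.
  by rewrite ger0_norm /q; lra.
have Bfin : lambda B \is a fin_num by rewrite fin_num_measure.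
have Bq m : fine (lambda B) <= q ^+ m.
  rewrite -lee_fin fineK// -lambda_avoidingE le_measure ?inE//.
    exact: measurable_ones_avoiding.
  exact: bigcap_inf.
apply/eqP; rewrite -(fineK Bfin) eqe eq_le fine_ge0// andbT.
rewrite -(cvg_lim _ (cvg_expr q01))//; apply: limr_ge.
  by apply/cvg_ex; exists 0; exact: cvg_expr.
by near=> m; exact: Bq.
Unshelve. all: by end_near.
Qed.

(** * Boxes and their layers *)

Definition unit_at (p : primes_type) : GG := [fsfun [fsfun] with p |-> 1%N].

Lemma unit_atE p q : unit_at p q = (q == p).
Proof.
by rewrite /unit_at /GG_coord fsfun_withE fsfunE; case: eqP.
Qed.

Lemma addE (g h : GG) p : GG_coord (g + h) p = (g p + h p)%N.
Proof. exact: GG_addE. Qed.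

Lemma addIG (h : GG) : injective (fun g : GG => g + h).
Proof.
move=> g g' gg'; apply/fsfunP => p; rewrite -!/(GG_coord _ _).
by have := addE g h p; rewrite gg' addE => /addIn.
Qed.

Definition box (k : GG) : {fset GG} := projT1 (cid (anchored_box_exists k)).

Lemma mem_box (k g : GG) : g \in box k <-> forall p, (g p <= k p)%N.
Proof. by rewrite /box; case: cid. Qed.

Definition translate (F : {fset GG}) (h : GG) : {fset GG} :=
  [fset g + h | g in F].

Lemma card_translate F h : #|` translate F h| = #|` F|.
Proof. by rewrite card_imfset//; exact: addIG. Qed.

Lemma box_coord0 (k : GG) p (g : GG) : k p = 0%N -> g \in box k -> g p = 0%N.
Proof. by move=> kp /mem_box /(_ p); rewrite kp leqn0 => /eqP. Qed.

(** Points of the two layers differ in the coordinate [p], which is 1 on the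
    first and 0 on the second. *)
Lemma disjoint_translates (k : GG) p q : k p = 0%N -> p != q ->
  [disjoint translate (box k) (unit_at p) & translate (box k) (unit_at q)]%fset.
Proof.
move=> kp pq; apply/fdisjointP => _ /imfsetP[/= g gk ->].
apply/negP => /imfsetP[/= h hk] /(congr1 (fun u : GG => u p)).
by rewrite !addE !unit_atE eqxx (negbTE pq) !(box_coord0 kp).
Qed.

Lemma disjoint_box_translate (k : GG) p : k p = 0%N ->
  [disjoint box k & translate (box k) (unit_at p)]%fset.
Proof.
move=> kp; apply/fdisjointP => g gk; apply/negP => /imfsetP[/= h hk].
move=> /(congr1 (fun u : GG => u p)).
by rewrite addE unit_atE eqxx !(box_coord0 kp).
Qed.

(** Raising the side in a flat direction from 0 to 1 doubles the box. *)
Lemma anchored_box_doubled (k : GG) p : k p = 0%N ->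
  anchored_box (box k `|` translate (box k) (unit_at p))%fset.
Proof.
move=> kp; exists (k + unit_at p) => g; rewrite in_fsetU; split.
  case/orP => [/mem_box gk q|/imfsetP[/= h /mem_box hk ->] q].
    by rewrite addE (leq_trans (gk q)) ?leq_addr.
  by rewrite !addE leq_add2r.
move=> gk; have [gp0|gp0] := eqVneq (g p) 0%N.
  apply/orP; left; apply/mem_box => q; have := gk q; rewrite addE unit_atE.
  by case: eqP => [->|_] /=; rewrite ?gp0 ?addn0.
have gp1 : g p = 1%N.
  have := gk p; rewrite addE unit_atE eqxx kp.
  by case: (g p) gp0 => // -[].
apply/orP; right; apply/imfsetP => /=.
pose h : GG := [fsfun g with p |-> 0%N].
have hE q : h q = if q == p then 0%N else g q.
  by rewrite /h /GG_coord fsfun_withE.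
exists h.
  apply/mem_box => q; rewrite hE; have := gk q; rewrite addE unit_atE.
  by case: eqP => //= _; rewrite addn0.
apply/fsfunP => q; rewrite -!/(GG_coord _ _) addE hE unit_atE.
by case: eqP => [->|_] /=; rewrite ?gp1 ?addn0.
Qed.

Lemma fresh_primes (k : GG) m : exists s : seq primes_type,
  [/\ size s = m, uniq s & {in s, forall p, k p = 0%N}].
Proof.
elim: m => [|m [s [sm us ks]]]; first by exists [::].
have [p pmax pp] := prime_above (\max_(q <- s ++ finsupp k) val q).
pose p' : primes_type := Sub p pp.
have fresh : p' \notin s ++ finsupp k.
  apply/negP => ps; move: pmax; rewrite ltnNge => /negP; apply.
  exact: (@leq_bigmax_seq _ _ xpredT (fun q : primes_type => val q) p' ps isT).
move: fresh; rewrite mem_cat negb_or => /andP[p's p'k].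
exists (p' :: s); split=> /=; [by rewrite sm|by rewrite p's|].
by move=> q; rewrite inE => /predU1P[->|/ks//]; exact: fsfun_dflt.
Qed.

(** * Almost every configuration has a full layer over every box *)

Definition no_full_layer (k : GG) : set config :=
  [set x | forall p, k p = 0%N -> ~ all_ones (translate (box k) (unit_at p)) x].

Lemma negligible_no_full_layer (R : realType) (lambda : probability config R) k :
  is_uniform_product lambda -> lambda.-negligible (no_full_layer k).
Proof.
move=> lambda_uniform.
pose layer p := translate (box k) (unit_at p).
pose s m := projT1 (cid (fresh_primes k m)).
have sP m : [/\ size (s m) = m, uniq (s m) & {in s m, forall p, k p = 0%N}].
  by rewrite /s; case: cid.
apply: (negligible_avoiding lambda_uniform (n := #|` box k|)
          (s := fun m => map layer (s m))) => m.
  have [sm um km] := sP m; split; first by rewrite size_map.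
    rewrite pairwise_map; move: um; rewrite uniq_pairwise.
    apply: (sub_in_pairwise (P := mem (s m))); last exact/allP.
    by move=> p q ps _; apply: disjoint_translates; exact: km.
  by move=> S /mapP[p _ ->]; exact: card_translate.
have [_ _ km] := sP m.
by move=> x H S /mapP[p ps ->]; apply: H; exact: km.
Qed.

(** * A full layer spoils the density of ones *)

Definition ones_in (x : config) (F : {fset GG}) : {fset GG} := [fset g in F | x g].

Lemma occ_singleton_one x F :
  occ [ffun _ : [fset (0 : GG)]%fset => true] x F = #|` ones_in x F|.
Proof.
rewrite /occ; congr #|` _|; rewrite -[RHS]set_fsetK; congr fset_set.
apply/seteqP; split=> g /=.
  by move=> /(_ [` fset11 0]) /=; rewrite ffunE add0r !inE /= => -[-> ->].
rewrite !inE /= => /andP[gF xg] [h hK] /=; rewrite ffunE.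
by move: hK; rewrite inE => /eqP ->; rewrite add0r.
Qed.

(** With tolerance 1/6, take for [k] the box [F0] given by net-normality. If some
    layer over it were full, [n] points with [a] ones would become [2 n] points
    with [a + n] ones; but [a / n > 1/3] and [(a + n) / (2 n) < 2/3] exclude
    each other. *)
Lemma net_normal_no_full_layer (R : realType) x :
  net_normal R x -> exists k, no_full_layer k x.
Proof.
move=> /(_ [fset (0 : GG)]%fset [ffun _ => true]) H.
have {H}[] := H _ 6^-1 _.
- by apply/fset0Pn; exists 0; rewrite in_fset1.
- by rewrite invr_gt0.
move=> F0 [[k kF0] H]; exists k => p kp full.
have F0E : F0 = box k.
  apply/fsetP => g; apply/idP/idP => [/kF0 ?|/mem_box ?]; first exact/mem_box.
  exact/kF0.
have := H _ (anchored_box_doubled kp); have := H (box k); rewrite F0E.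
rewrite !occ_singleton_one cardfs1 expr1 => H1 H2.
have {}H1 := H1 (ex_intro _ k (mem_box k)) (fsubset_refl _).
have {}H2 := H2 (fsubsetUl _ _).
have dis := disjoint_box_translate kp.
set T := translate _ _ in full H2 dis.
have cardT : #|` T| = #|` box k| by exact: card_translate.
have cardU : #|` (box k `|` T)%fset| = (#|` box k| + #|` box k|)%N.
  by rewrite cardfsU (eqP dis) cardfs0 subn0 cardT.
have onesU : #|` ones_in x (box k `|` T)%fset| =
    (#|` ones_in x (box k)| + #|` box k|)%N.
  rewrite -[in RHS]cardT.
  have -> : ones_in x (box k `|` T)%fset = (ones_in x (box k) `|` T)%fset.
    apply/fsetP => g; rewrite !inE /=.
    by case: (boolP (g \in T)) => [/full ->|]; rewrite ?orbT ?orbF.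
  rewrite cardfsU (_ : (_ `&` T)%fset = fset0) ?cardfs0 ?subn0//.
  apply/eqP/(fdisjointWl _ dis); apply/fsubsetP => g.
  by rewrite !inE => /andP[].
move: H1 H2; rewrite cardU onesU !natrD.
have : (0 < #|` box k|)%N.
  rewrite cardfs_gt0; apply/fset0Pn; exists 0; apply/mem_box => q.
  by rewrite /GG_coord fsfunE.
rewrite -(ltr_nat R).
move: (#|` box k|%:R) (#|` ones_in x _|%:R) => n a n0.
rewrite !ltr_norml => /andP[Ha _] /andP[_ Hb].
move: Ha Hb; rewrite ltrBrDr ltr_pdivlMr// ltrBlDr ltr_pdivrMr ?addr_gt0//.
lra.
Qed.

Theorem theorem6p6 (R : realType) (lambda : probability config R)
    (lambda_uniform : is_uniform_product lambda) :
  (lambda.-negligible (net_normal R))%classic.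
Proof.
pose A n := if choice.unpickle n is Some k then no_full_layer k else set0.
apply: (@negligibleS _ _ _ _ (\bigcup_n A n)).
  move=> x /net_normal_no_full_layer[k xk].
  by exists (choice.pickle k) => //; rewrite /A choice.pickleK.
apply: negligible_bigcup => n; rewrite /A.
case: choice.unpickle => [k|]; last exact: negligible_set0.
exact: negligible_no_full_layer.
Qed.
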